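(* Let $E=\bigsqcup_{n\in\omega}E_n$ be a continuous signature and let $X$ be a topological $E$-algebra. If the product $E_n\times X^n$ is Lindelöf for every $n\in\mathrm{Sp}\,E$, then $X$ is $\mathbb R$-factorizable.
   Context: All spaces are Tychonoff. A continuous signature is a space $E$ that is the disjoint union of clopen (possibly empty) subsets $E_n$, $n\in\omega=\{0,1,2,\dots\}$; $\mathrm{Sp}\,E=\{n\in\omega: E_n\ne\varnothing\}$. An $E$-algebra is a set $X$ with maps $\mathfrak e^X_n\colon E_n\times X^n\to X$, $n\in\omega$ ($X^0$ is a singleton). A topological $E$-algebra is an $E$-algebra endowed with a topology making all $\mathfrak e^X_n$ continuous. A homomorphism is a map commuting with all operations. A topological $E$-algebra $X$ is $\mathbb R$-factorizable if for every continuous $f\colon X\to\mathbb R$ there are a separable metrizable topological $E$-algebra $Y$, a continuous function $g\colon Y\to\mathbb R$ and a continuous homomorphism $h\colon X\to Y$ with $f=g\circ h$. *)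

(* Defs.v *)
From mathcomp Require Import all_boot all_order all_algebra.
From mathcomp Require Import all_classical all_reals all_analysis.

Set Implicit Arguments.
Unset Strict Implicit.
Unset Printing Implicit Defensive.

Import numFieldNormedType.Exports.
Local Open Scope classical_set_scope.

Definition tychonoff_space (T : topologicalType) : Prop :=
  accessible_space T /\ completely_regular_space T.

Definition lindelof_space (T : topologicalType) : Prop :=
  forall F : set (set T), F `<=` open -> \bigcup_(U in F) U = [set: T] ->
  exists G : set (set T),
    [/\ G `<=` F, countable G & \bigcup_(U in G) U = [set: T]].

Definition separable_space (T : topologicalType) : Prop :=
  exists D : set T, countable D /\ dense D.

(* [E_ n] is the n-th piece of the signature [E]; pieces may be empty, and a
   piece used as a type carries the subspace topology. *)
Definition continuous_signature (E : topologicalType) (E_ : nat -> set E) :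
    Prop :=
  [/\ tychonoff_space E, forall n, clopen (E_ n),
      trivIset [set: nat] E_ & \bigcup_n E_ n = [set: E]].

Definition Sp (E : topologicalType) (E_ : nat -> set E) : set nat :=
  [set n | E_ n !=set0].

(* X^n is the set of maps 'I_n -> X; [{ptws 'I_n -> X}] gives it the product
   topology when X is a topological space. *)
Definition algebra_ops (E : topologicalType) (E_ : nat -> set E) (X : Type) :
    Type :=
  forall n : nat, set_type (E_ n) * {ptws 'I_n -> X} -> X.

Definition topological_algebra (E : topologicalType) (E_ : nat -> set E)
    (X : topologicalType) (eX : algebra_ops E_ X) : Prop :=
  tychonoff_space X /\ forall n, continuous (eX n).

Definition homomorphism (E : topologicalType) (E_ : nat -> set E) (X Y : Type)
    (eX : algebra_ops E_ X) (eY : algebra_ops E_ Y) (h : X -> Y) : Prop :=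
  forall (n : nat) (c : set_type (E_ n)) (x : 'I_n -> X),
    h (eX n (c, x)) = eY n (c, h \o x).

(* A separable metrizable space is a separable space whose topology is the one
   of some metric, hence the quantification over [Y : metricType R]; nothing
   below depends on the metric of [Y] beyond its topology. *)
Definition R_factorizable (R : realType) (E : topologicalType)
    (E_ : nat -> set E) (X : topologicalType) (eX : algebra_ops E_ X) : Prop :=
  forall f : X -> R, continuous f ->
  exists (Y : metricType R) (eY : algebra_ops E_ Y) (g : Y -> R) (h : X -> Y),
    [/\ separable_space Y, topological_algebra eY, continuous g,
        continuous h /\ homomorphism eX eY h & f = g \o h].

(* Main.v *)
(* Call a continuous phi : X -> R controlled by a set S of real functions on X
   if phi o e_n becomes continuous when each factor X is given the initial
   topology of S.  Since X is Tychonoff, each point of E_n * X^n has, for every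
   error 1/(k+1), a neighbourhood U * {x | psi_i (x_i) < 1 for all i}
   on which phi o e_n oscillates by less than that error; since E_n * X^n is
   Lindelof, countably many such boxes suffice.  So phi is controlled by a
   countable set, and iterating omega times from f gives a countable family F
   containing f that controls each of its members.  The algebra Y is the image
   of X in R^nat under F, to which the operations descend continuously. *)
Require Import Defs.
From HB Require Import structures.
From mathcomp Require Import all_boot all_order all_algebra.
From mathcomp Require Import all_classical all_reals all_analysis.
From mathcomp Require Import lra.

Set Implicit Arguments.
Unset Strict Implicit.
Unset Printing Implicit Defensive.

Import Order.TTheory GRing.Theory Num.Theory.
Import numFieldNormedType.Exports.
Local Open Scope classical_set_scope.
Local Open Scope ring_scope.

(* A copy of [S] that does not inherit any topology already put on
   [nat -> R]. *)
Definition seqspace (R : realType) (S : set (nat -> R)) : Type :=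
  {a : nat -> R | S a}.

(** * Metrizing pointwise convergence on a set of real sequences *)

Section Seqspace.
Context {R : realType} {S : set (nat -> R)}.
Local Notation Y := (seqspace S).
Implicit Types a b : Y.

Definition coord (j : nat) (a : Y) : R := sval a j.

(** Truncating at 1/(j+1) keeps the supremum finite and makes late coordinates negligible, so that
    the sup metric induces pointwise convergence. *)
Definition trunc_dist a b (j : nat) : R :=
  Num.min `|coord j a - coord j b| j.+1%:R^-1.

Definition seqdist a b : R := sup (range (trunc_dist a b)).

Let trunc_dist_le_seqdist a b j : trunc_dist a b j <= seqdist a b.
Proof.
apply: ub_le_sup; last by exists j.
exists 1 => _ [k _ <-]; rewrite /trunc_dist ge_min; apply/orP; right.
by rewrite invf_le1 ?ltr0n// ler1n.
Qed.

Let seqdist_le a b x : (forall j, trunc_dist a b j <= x) -> seqdist a b <= x.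
Proof.
move=> le_x; apply: (@ge_sup R _ x); last by move=> _ [j _ <-].
by exists (trunc_dist a b 0%N); exists 0%N.
Qed.

Let seqdistxx a : seqdist a a = 0.
Proof.
have trunc0 j : trunc_dist a a j = 0 by rewrite /trunc_dist subrr normr0 min_l.
apply/eqP; rewrite eq_le seqdist_le => [|j]; last by rewrite trunc0.
by rewrite -(trunc0 0%N) trunc_dist_le_seqdist.
Qed.

Let seqdist_positivity a b : seqdist a b = 0 -> a = b.
Proof.
move=> d0; apply: eq_sig_hprop => [x|]; first exact: Prop_irrelevance.
apply/funext => j; apply/eqP; rewrite -subr_eq0 -normr_le0.
have := trunc_dist_le_seqdist a b j.
by rewrite d0 /trunc_dist ge_min [X in _ || X]leNgt invr_gt0 ltr0n orbF.
Qed.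

Let seqdist_sym a b : seqdist a b = seqdist b a.
Proof.
rewrite /seqdist; suff -> : trunc_dist a b = trunc_dist b a by [].
by apply/funext => j; rewrite /trunc_dist distrC.
Qed.

Let seqdist_triangle b a (c : Y) : seqdist a c <= seqdist a b + seqdist b c.
Proof.
apply: seqdist_le => j.
apply: (@le_trans _ _ (trunc_dist a b j + trunc_dist b c j)); last exact: lerD.
have := ler_distD (coord j b) (coord j a) (coord j c).
have : 0 < j.+1%:R^-1 :> R by rewrite invr_gt0 ltr0n.
have := normr_ge0 (coord j a - coord j b).
have := normr_ge0 (coord j b - coord j c).
rewrite /trunc_dist; move: `|_ - _| `|_ - _| `|_ - _| _^-1 => x y z t *.
by rewrite /Num.min; case: ltP => ?; case: ltP => ?; case: ltP => ?; lra.
Qed.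

HB.instance Definition _ := gen_eqMixin Y.
HB.instance Definition _ := gen_choiceMixin Y.
HB.instance Definition _ := @isMetric.Build R Y
  seqdist seqdistxx seqdist_positivity seqdist_sym seqdist_triangle.

Lemma nbhs_seqspaceP (a : Y) (A : set Y) :
  nbhs a A <-> exists (m : nat) (d : R), 0 < d /\
    forall b, (forall j, (j < m)%N -> `|coord j a - coord j b| < d) -> A b.
Proof.
split.
  rewrite -filter_from_ballE => -[e /= e0 aeA].
  (* The supremum inherits only a non-strict bound; [e / 2] leaves room for a strict one. *)
  have e20 : 0 < e / 2 by rewrite divr_gt0.
  have [m me] : exists m : nat, m.+1%:R^-1 < e / 2.
    by have [m] := ltr_add_invr e20; rewrite add0r; exists m.
  exists m, (e / 2); split=> // b ab; apply: aeA.
  rewrite ballEmdist/=; apply: (@le_lt_trans _ _ (e / 2)); last lra.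
  apply: seqdist_le => j; rewrite /trunc_dist ge_min.
  have [/ab/ltW ->//|mj] := ltnP j m; apply/orP; right.
  by rewrite (le_trans _ (ltW me))// lef_pV2 ?posrE ?ltr0n// ler_nat ltnS.
move=> [m [d [d0 aA]]]; rewrite -filter_from_ballE.
have m0 : 0 < m.+1%:R^-1 :> R by rewrite invr_gt0 ltr0n.
(* Below 1/(m+1), the truncation at 1/(j+1) cannot be the smaller term for j < m. *)
exists (Num.min d m.+1%:R^-1) => /=; first by rewrite lt_min d0.
move=> b; rewrite ballEmdist/= lt_min => /andP[abd abm]; apply: aA => j jm.
have := trunc_dist_le_seqdist a b j; rewrite /trunc_dist ge_min.
move=> /orP[/le_lt_trans->//|/le_lt_trans/(_ abm)].
by rewrite ltf_pV2 ?posrE ?ltr0n// ltr_nat ltnS ltnNge (ltnW jm).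
Qed.

Lemma coord_continuous j : continuous (coord j : Y -> R).
Proof.
move=> a; have nbhsF : Filter (nbhs a) by exact: nbhs_filter.
apply/cvgrPdist_lt => e e0.
apply/nbhs_seqspaceP; exists j.+1, e; split=> // b; exact.
Qed.

Lemma cvg_seqspace (F : set_system Y) (a : Y) : Filter F ->
  (forall j, coord j @ F --> coord j a) -> F --> a.
Proof.
move=> FF Fa A /nbhs_seqspaceP[m [d [d0 aA]]].
have : F [set b | forall j : 'I_m, `|coord j a - coord j b| < d].
  by apply: filter_forall => j; move/cvgrPdist_lt: (Fa j); apply.
by apply: filterS => b ab; apply: aA => j jm; exact: (ab (Ordinal jm)).
Qed.

(** Rational sequences may lie outside [S], so for each finite rational sequence and each precision
    a nearby point of [Y] is chosen, when there is one. *)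
Lemma seqspace_separable : separable_space Y.
Proof.
pose near_pt (c : seq rat * nat) (b : Y) := forall j, (j < size c.1)%N ->
  `|ratr c.1`_j - coord j b| < c.2.+1%:R^-1.
pose pt (c : {c | near_pt c !=set0}) : Y := sval (cid (svalP c)).
have ptP c : near_pt (sval c) (pt c) by rewrite /pt; case: cid.
exists (range pt); split.
  apply: sub_countable (card_image_le _ _) _.
  apply/countable_injP; exists (fun c => pickle (sval c)).
  move=> [c ?] [d ?] _ _ /= /(pcan_inj pickleK) cd.
  by apply: eq_sig_hprop => // x; exact: Prop_irrelevance.
move=> O [a Oa] oO.
have /nbhs_seqspaceP[m [d [d0 aO]]] : nbhs a O by exact: open_nbhs_nbhs.
have [k kd] : exists k : nat, k.+1%:R^-1 < d / 2.
  have d20 : 0 < d / 2 by rewrite divr_gt0.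
  by have [k] := ltr_add_invr d20; rewrite add0r; exists k.
have /choice[q qa] : forall j, exists q : rat,
    `|ratr q - coord j a| < k.+1%:R^-1.
  move=> j; have : coord j a < coord j a + k.+1%:R^-1.
    by rewrite ltrDl invr_gt0 ltr0n.
  move=> /rat_in_itvoo[q]; rewrite in_itv/= => /andP[aq qk].
  by exists q; rewrite gtr0_norm ?subr_gt0// ltrBlDl.
have near_a : near_pt (mkseq q m, k) a.
  by move=> j; rewrite size_mkseq => jm; rewrite nth_mkseq.
pose c : {c | near_pt c !=set0} := exist _ _ (ex_intro _ a near_a).
exists (pt c); split; last by exists c.
apply: aO => j jm; have := ptP c j; rewrite size_mkseq nth_mkseq//= => /(_ jm).
move=> /(ltrD (qa j)) lt_kk; rewrite (splitr d).
apply: lt_trans (ltrD kd kd); apply: le_lt_trans lt_kk.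
by rewrite (distrC (ratr _) (coord j a)) ler_distD.
Qed.

Lemma seqspace_tychonoff : tychonoff_space Y.
Proof.
split; last exact: uniform_completely_regular.
exact/hausdorff_accessible/metric_hausdorff.
Qed.

End Seqspace.

(** * Boxes in products and countable subcovers *)

Lemma nbhs_ptws_box (I : Type) (X : topologicalType) (x : {ptws I -> X})
    (Q : set {ptws I -> X}) : nbhs x Q ->
  exists2 V : I -> set X, forall i, nbhs (x i) (V i) &
    [set z : {ptws I -> X} | forall i, V i (z i)] `<=` Q.
Proof.
pose boxes := filter_from [set V : I -> set X | forall i, nbhs (x i) (V i)]
  (fun V => [set z : {ptws I -> X} | forall i, V i (z i)]).
have boxesF : Filter boxes.
  apply: filter_from_filter; first by exists (fun=> setT) => i; exact: filterT.
  move=> V W nV nW; exists (fun i => V i `&` W i).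
    by move=> i; apply: filterI; [exact: nV|exact: nW].
  by move=> z VWz; split=> i; have [] := VWz i.
(* The product topology is a supremum of initial topologies, so convergence of the box filter is
   checked one projection at a time. *)
suff /[apply] -[V nV VQ] : boxes --> x by exists V.
apply/cvg_sup => i U [_ [[W oW <-]] Wxi WU].
exists (fun j => [set y | j = i -> W y]).
  move=> /= j; have [->|ji] := pselect (j = i).
    by apply: filterS (open_nbhs_nbhs (conj oW Wxi)) => y Wy _.
  by apply: filterS filterT => y _ /ji.
by move=> z Wz; apply: WU; exact: Wz.
Qed.

(** Indices are returned rather than sets, since the functions defining a box are needed later; [i0]
    fills the places that code no member of the subcover. *)
Lemma lindelof_sequence (T : topologicalType) (I : Type) (B : I -> set T)
    (P : set I) (i0 : I) :
  lindelof_space T -> P i0 -> (forall i, P i -> open (B i)) ->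
  (forall t, exists2 i, P i & B i t) ->
  exists s : nat -> I, (forall k, P (s k)) /\ forall t, exists k, B (s k) t.
Proof.
move=> lT Pi0 oB covB.
have [||G [GB /countable_injP[code code_inj] covG]] := lT [set B i | i in P].
- by move=> _ [i Pi <-]; exact: oB.
- rewrite -subTset => t _; have [i Pi Bit] := covB t.
  by exists (B i) => //; exists i.
have /choice[s sP] : forall k, exists i, P i /\
    forall W, G W -> code W = k -> B i = W.
  move=> k; have [[W [GW Wk]]|noW] := pselect (exists W, G W /\ code W = k).
    have [i Pi BiW] := GB _ GW; exists i; split=> // W' GW' W'k.
    by rewrite BiW; apply: code_inj; rewrite ?inE// Wk.
  by exists i0; split=> // W GW Wk; case: noW; exists W.
exists s; split=> [k|t]; first by have [] := sP k.
have [W GW Wt] : (\bigcup_(U in G) U) t by rewrite covG.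
by exists (code W); have [_ /(_ W GW erefl) ->] := sP (code W).
Qed.

(** * Control by countable families of continuous functions *)

Section Controlled.
Context {R : realType} {E : topologicalType} {E_ : nat -> set E}.
Context {X : topologicalType} (eX : algebra_ops E_ X).

(** The bound 1 suits separating functions that are 0 at a point and 1 off a neighbourhood of it. *)
Definition box n (b : set (set_type (E_ n)) * ('I_n -> X -> R)) :
    set (set_type (E_ n) * {ptws 'I_n -> X}) :=
  [set p | b.1 p.1 /\ forall i, b.2 i (p.2 i) < 1].

Definition small_box (phi : X -> R) n (e : R) :
    set (set (set_type (E_ n)) * ('I_n -> X -> R)) :=
  [set b | [/\ open b.1, forall i, continuous (b.2 i) &
    forall p q, box b p -> box b q -> `|phi (eX p) - phi (eX q)| < e]].

(* Up to any error, [phi \o eX n] is locally determined by an open set of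
   operation symbols and finitely many functions of [S]. *)
Definition controlled (S : set (X -> R)) (phi : X -> R) :=
  forall n (p : set_type (E_ n) * {ptws 'I_n -> X}) (e : R), 0 < e ->
  exists2 b, small_box phi e b & (forall i, S (b.2 i)) /\ box b p.

Context (crX : completely_regular_space X).
Context (cX : forall n, continuous (@eX n)).
Context (hL : forall n, Sp E_ n ->
  lindelof_space (set_type (E_ n) * {ptws 'I_n -> X})%type).

Lemma open_box n (b : set (set_type (E_ n)) * ('I_n -> X -> R)) :
  open b.1 -> (forall i, continuous (b.2 i)) -> open (box b).
Proof.
move=> oU cpsi; rewrite openE => -[c x] [/= Uc psix].
have : \forall p \near ((c, x) : set_type (E_ n) * {ptws 'I_n -> X}),
    forall i, b.2 i (p.2 i) < 1.
  apply: (@filter_forall _ _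
    (fun i (p : set_type (E_ n) * {ptws 'I_n -> X}) => b.2 i (p.2 i) < 1)
    (nbhs (c, x))) => i.
  have cvgi : (fun p : set_type (E_ n) * {ptws 'I_n -> X} => b.2 i (p.2 i)) @
      nbhs (c, x) --> b.2 i (x i).
    apply: (cvg_comp (fun p => p.2 i)); last exact: cpsi.
    apply: (cvg_comp snd (@proj _ (fun=> X) i)); first exact: cvg_snd.
    exact: (@proj_continuous _ (fun=> X) i).
  exact: cvgr_lt cvgi _ (psix i).
by apply: filterI; exact: cvg_fst (open_nbhs_nbhs (conj oU Uc)).
Qed.

(** Continuity gives a product neighbourhood of small oscillation; complete regularity puts inside
    each factor a set where a continuous function is below 1. *)
Lemma small_box_exists (phi : X -> R) n (e : R)
    (p : set_type (E_ n) * {ptws 'I_n -> X}) :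
  continuous phi -> 0 < e -> exists2 b, small_box phi e b & box b p.
Proof.
case: p => c x cphi e0.
have cphie : phi \o @eX n @ nbhs (c, x) --> phi (eX (c, x)).
  by apply: (cvg_comp (@eX n)); [exact: cX|exact: cphi].
(* Two points of the box are compared through its centre [(c, x)]. *)
have e2 : 0 < e / 2 by rewrite divr_gt0.
move/cvgrPdist_lt: cphie => /(_ _ e2)[[P Q] /= [nP nQ] PQ].
have [V nV VQ] := nbhs_ptws_box nQ.
have /choice[psi psiP] : forall i, exists psi : X -> R,
    [/\ continuous psi, psi (x i) < 1 & forall y, psi y < 1 -> V i y].
  move=> i.
  have /(@uniform_separatorP _ R)[g [cg _ g0 g1]] :
      uniform_separator [set x i] (~` (V i)°).
    apply: crX; first exact/open_closedC/open_interior.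
    by move=> /(_ (nV i)).
  exists g; split=> //.
    by rewrite (g0 (g (x i)))// ?ltr01//; exists (x i).
  move=> y gy; apply: interior_subset; apply: contrapT => nVy.
  by move: gy; rewrite (g1 (g y)) ?ltxx//; exists y.
exists (P°, psi); last by split=> //= i; have [] := psiP i.
split=> /=; [exact: open_interior|by move=> i; have [] := psiP i|].
have boxPQ q : box (P°, psi) q -> `|phi (eX (c, x)) - phi (eX q)| < e / 2.
  case: q => c' x' [/= Pc' x'1]; apply: (PQ (c', x')); split=> /=.
    exact: interior_subset.
  by apply: VQ => i; have [_ _] := psiP i; apply.
move=> q r /boxPQ + /boxPQ r2; rewrite distrC => q2; rewrite (splitr e).
exact: le_lt_trans (ler_distD _ _ _) (ltrD q2 r2).
Qed.

(** For each arity and each error 1/(k+1), countably many small boxes cover the product; [S] gathers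
    the finitely many functions of each box. *)
Lemma controlled_countable (phi : X -> R) : continuous phi ->
  exists S : set (X -> R),
    [/\ countable S, S `<=` [set psi | continuous psi] & controlled S phi].
Proof.
move=> cphi.
have exs : forall nk : nat * nat, exists
    s : nat -> set (set_type (E_ nk.1)) * ('I_nk.1 -> X -> R),
    (forall m, small_box phi nk.2.+1%:R^-1 (s m)) /\
    forall p, exists m, box (s m) p.
  move=> [n k] /=.
  have k0 : 0 < k.+1%:R^-1 :> R by rewrite invr_gt0 ltr0n.
  (* The empty box, small for a vacuous reason, is the default index. *)
  have small0 : small_box phi k.+1%:R^-1
      (set0 : set (set_type (E_ n)), fun (_ : 'I_n) (_ : X) => 0).
    by split=> [|i|? ? []//]; [exact: open0|exact: cst_continuous].
  (* If [E_ n] is empty then so is the product, and any sequence of small boxes covers it. *)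
  have [En|nEn] := pselect (Sp E_ n); last first.
    exists (fun=> (set0, fun _ _ => 0)); split=> // -[[c cE] x].
    by case: nEn; exists c; exact/set_mem.
  have [||s [? ?]] := lindelof_sequence (B := @box n) (hL En) small0.
  - by move=> b [? ? _]; exact: open_box.
  - by move=> p; exact: small_box_exists.
  by exists s.
pose s nk := sval (cid (exs nk)); have sP nk := svalP (cid (exs nk)).
exists (range (fun t : {nk : nat * nat & (nat * 'I_nk.1)%type} =>
  (s (tag t) (tagged t).1).2 (tagged t).2)); split.
- apply: sub_countable (card_image_le _ _) _; exact: countableP.
- by move=> _ [[nk [m i]] _ <-]; have [/(_ m)[_ + _] _] := sP nk; exact.
move=> n p e e0.
have [k ke] : exists k : nat, k.+1%:R^-1 < e.
  by have [k] := ltr_add_invr e0; rewrite add0r; exists k.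
have [/= smallS /(_ p)[m boxp]] := sP (n, k).
exists (s (n, k) m).
  have [? ? lt_k] := smallS m; split=> // q r bq br.
  exact: lt_trans (lt_k _ _ bq br) ke.
split=> // i; exists (Tagged (fun nk : nat * nat => (nat * 'I_nk.1)%type)
  ((m, i) : nat * 'I_(n, k).1)) => //.
Qed.

Lemma controlled_sequence (f : X -> R) : continuous f ->
  exists F : nat -> X -> R, [/\ range F f, forall j, continuous (F j) &
    forall j, controlled (range F) (F j)].
Proof.
move=> cf.
have /choice[S SP] : forall phi : X -> R, exists S : set (X -> R),
    continuous phi -> [/\ countable S, S `<=` [set psi | continuous psi] &
      controlled S phi].
  move=> phi.
  have [/controlled_countable[S ?]|?] := pselect (continuous phi).
    by exists S.
  by exists set0.
(* Each level supplies the functions that control the previous one, so the union of all levels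
   controls each of its members. *)
pose fix level k : set (X -> R) :=
  if k is k'.+1 then \bigcup_(phi in level k') S phi else [set f].
have level_cont k : level k `<=` [set psi | continuous psi].
  elim: k => [_ ->//|k IH psi [phi /IH /SP[_ + _]]]; exact.
have level_countable k : countable (level k).
  elim: k => [|k IH]; first exact: countable1.
  by apply: bigcup_countable => // phi /level_cont/SP[].
pose T := \bigcup_k level k.
have [code code_inj] : exists code : (X -> R) -> nat, {in T &, injective code}.
  by apply/countable_injP; exact: bigcup_countable.
have Tf : T f by exists 0%N.
(* [F] enumerates [T], with value [f] at numbers that code no member. *)
have /choice[F FP] : forall k, exists phi, T phi /\
    forall psi, T psi -> code psi = k -> phi = psi.
  move=> k.
  have [[psi [Tpsi <-]]|no] := pselect (exists psi, T psi /\ code psi = k).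
    by exists psi; split=> // xi Txi xik; apply: code_inj; rewrite ?inE.
  by exists f; split=> // psi Tpsi psik; case: no; exists psi.
have TF phi : T phi -> range F phi.
  move=> Tphi; exists (code phi) => //.
  by have [_ /(_ _ Tphi erefl)] := FP (code phi).
exists F; split=> [|j|j]; first exact: TF.
  by have [[k _ /level_cont]] := FP j.
have [[k _ kFj] _] := FP j.
have [_ _ ctrl] := SP _ (level_cont k _ kFj).
move=> n p e /(ctrl n p)[b small_b [Sb bp]]; exists b => //; split=> // i.
by apply: TF; exists k.+1 => //; exists (F j).
Qed.

End Controlled.

(** * The algebra structure on the image of [X] in the space of sequences *)

Theorem theorem14 (R : realType) (E : topologicalType) (E_ : nat -> set E)
    (X : topologicalType) (eX : algebra_ops E_ X)
    (hE : continuous_signature E_) (hX : topological_algebra eX)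
    (hL : forall n : nat, Sp E_ n ->
      lindelof_space (set_type (E_ n) * {ptws 'I_n -> X})%type) :
  R_factorizable R eX.
Proof.
move=> f cf; have [[_ crX] cX] := hX.
have [F [[j0 _ Fj0] cF ctrlF]] := controlled_sequence crX cX hL cf.
pose H x j := F j x.
pose Y := seqspace (range H).
pose h x : Y := exist _ (H x) (ex_intro2 _ _ x I erefl).
have /choice[s hs] : forall y : Y, exists x, h x = y.
  move=> [a [x xT Hxa]]; exists x; apply: eq_sig_hprop => [?|//].
  exact: Prop_irrelevance.
(* Operations are computed on representatives chosen by [s]; [homH] shows that the choice does not
   matter. *)
pose eY : algebra_ops E_ Y := fun n p => h (eX n (p.1, s \o p.2)).
have coordE j x : coord j (h x) = F j x by [].
have Fs j y : F j (s y) = coord j y by rewrite -coordE hs.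
have homH : homomorphism eX eY h.
  move=> n c x; rewrite /eY /=.
  suff eqF j : F j (eX n (c, x)) = F j (eX n (c, s \o (h \o x))).
    by apply: eq_sig_hprop => [?|]; [exact: Prop_irrelevance|exact: funext].
  (* Every [F k] agrees on [x] and [s \o (h \o x)], so both lie in the same boxes cut out by [F],
     and the two values differ by less than any [e]. *)
  apply/eqP; rewrite -subr_eq0 -normr_le0; apply/ler_addgt0Pl => e e0.
  rewrite addr0.
  have [b [_ _ small] [Sb [bc bx]]] := ctrlF j n (c, x) e e0.
  apply/ltW/small; split=> //= i.
  by have [k _ Fk] := Sb i; rewrite -Fk Fs coordE Fk bx.
exists Y, eY, (coord j0), h; split.
- exact: seqspace_separable.
- split=> [|n [c y]]; first exact: seqspace_tychonoff.
  apply: cvg_seqspace => j; apply/cvgrPdist_lt => e e0.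
  have [b [ob1 cb small] [Sb [bc bx]]] := ctrlF j n (c, s \o y) e e0.
  (* Composed with [s], the functions of the box become coordinates of [Y], so the box pulls back to
     an open one even if [s] is discontinuous. *)
  have oYb : open (box (X := Y) (b.1, fun i => b.2 i \o s)).
    apply: open_box => //= i; have [k _ <-] := Sb i.
    suff -> : F k \o s = coord k by exact: coord_continuous.
    by apply/funext => z; exact: Fs.
  have : nbhs ((c, y) : set_type (E_ n) * {ptws 'I_n -> Y})
      (box (X := Y) (b.1, fun i => b.2 i \o s)).
    exact: open_nbhs_nbhs.
  by apply: filterS => q bq; apply: small.
- exact: coord_continuous.
- split=> // x; apply: cvg_seqspace => j; exact: cF.
- by rewrite -Fj0.
Qed.
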